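(* Let $\mathbb K$ be a field, $R=\mathbb K[x_0,\dots,x_n]$, let $J\subset R$ be a quasi-stable monomial ideal, let $I\subset R$ be a homogeneous ideal generated by a $\mathcal P_J$-marked basis $\mathcal H$, and let $d$ be the Krull dimension of $R/I$ (which equals that of $R/J$). If $x_0,\dots,x_{d-1}$ is an $R/J$-regular sequence, then: (i) $x_0,\dots,x_{d-1}$ is also an $R/I$-regular sequence; and (ii) the polynomials obtained from the $\mathcal P_J$-marked basis $\mathcal H$ of $I$ by setting $x_0=\dots=x_{d-1}=0$ form a marked basis of the Artinian reduction $(I+(x_0,\dots,x_{d-1}))/(x_0,\dots,x_{d-1})$ of $I$ over the quasi-stable ideal $(J+(x_0,\dots,x_{d-1}))/(x_0,\dots,x_{d-1})$ (both viewed as ideals of $R/(x_0,\dots,x_{d-1})\cong\mathbb K[x_d,\dots,x_n]$).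
   Context: $R=\mathbb K[x_0,\dots,x_n]$ has the standard grading and variables ordered $x_0<x_1<\dots<x_n$. A term is a monomial $x^\alpha=x_0^{\alpha_0}\cdots x_n^{\alpha_n}$; for $x^\alpha\neq 1$, $\min(x^\alpha)$ (resp. $\max(x^\alpha)$) is the smallest (resp. largest) variable dividing $x^\alpha$. A monomial ideal $J$ is quasi-stable if for every term $x^\tau\in J$ and every variable $x_k>\min(x^\tau)$ there is an exponent $s_k$ with $\frac{x^\tau}{\min(x^\tau)}x_k^{s_k}\in J$. This holds if and only if $J$ has a (unique) Pommaret basis $\mathcal P_J$: a finite set of terms generating $J$ such that for every term $x^\tau\in J\setminus\mathcal P_J$ there is a unique $x^\sigma\in\mathcal P_J$ with $x^\tau=x^\delta x^\sigma$ and $\max(x^\delta)\le\min(x^\sigma)$. $\mathcal N(J)$ is the set of terms not in $J$, and $\mathcal N(J)_t$ its subset of terms of degree $t$. A $\mathcal P_J$-marked set is a set $\mathcal H=\{h_\alpha\}_{x^\alpha\in\mathcal P_J}\subset R$ of homogeneous polynomials, one for each $x^\alpha\in\mathcal P_J$, such that $x^\alpha$ (the head term of $h_\alpha$) occurs in $h_\alpha$ with coefficient $1$ and all other terms occurring in $h_\alpha$ belong to $\mathcal N(J)$. It is a $\mathcal P_J$-marked basis if $R_t=(\mathcal H)_t\oplus\langle\mathcal N(J)_t\rangle_{\mathbb K}$ for every degree $t$. The same definitions are used in $\mathbb K[x_d,\dots,x_n]$ with $x_d<\dots<x_n$; ''marked basis over a quasi-stable ideal $J'$'' means $\mathcal P_{J'}$-marked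 basis. *)

(* Defs.v *)
From mathcomp Require Import all_boot all_order all_algebra.
From mathcomp Require Export mpoly.

Set Implicit Arguments.
Unset Strict Implicit.
Unset Printing Implicit Defensive.

Import GRing.Theory.
Local Open Scope ring_scope.

Section Ideals.
Variable A : comNzRingType.
Implicit Types (I S P : A -> Prop) (s : seq A).

Record is_ideal I : Prop := IsIdeal {
  ideal_zero : I 0;
  ideal_add : forall f g, I f -> I g -> I (f + g);
  ideal_mul : forall f g, I g -> I (f * g) }.

Definition ideal_gen S : A -> Prop := fun f =>
  exists2 cs : seq (A * A),
    (forall c, c \in cs -> S c.2) & f = \sum_(c <- cs) c.1 * c.2.

Definition ideal_adjoin I s : A -> Prop := ideal_gen (fun g => I g \/ g \in s).

Record is_prime P : Prop := IsPrime {
  prime_is_ideal : is_ideal P;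
  prime_proper : ~ P 1;
  prime_mul : forall f g, P (f * g) -> P f \/ P g }.

(* The ideals (resp. prime ideals) of A/I are identified with those of A that
   contain I, and elements of A/I are handled through representatives. *)

Definition prime_chain_over I (l : nat) : Prop :=
  exists Q : nat -> A -> Prop,
    [/\ forall i, (i <= l)%N -> is_prime (Q i),
        forall i, (i <= l)%N -> forall f, I f -> Q i f &
        forall i, (i < l)%N ->
          (forall f, Q i f -> Q i.+1 f) /\ (exists2 f, Q i.+1 f & ~ Q i f)].

(* There is no such d when I is the unit ideal. *)
Definition krull_dim_quotient I (d : nat) : Prop :=
  prime_chain_over I d /\ forall l, prime_chain_over I l -> (l <= d)%N.

Definition artinian_quotient I : Prop :=
  forall C : nat -> A -> Prop,
    (forall k, is_ideal (C k)) -> (forall k f, I f -> C k f) ->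
    (forall k f, C k.+1 f -> C k f) ->
    exists N, forall k, (N <= k)%N -> forall f, C N f -> C k f.

Definition regular_sequence_quotient I s : Prop :=
  (forall i, (i < size s)%N -> forall f,
     ideal_adjoin I (take i s) (s`_i * f) -> ideal_adjoin I (take i s) f)
  /\ ~ ideal_adjoin I s 1.

End Ideals.

Section MarkedBases.
Variables (K : fieldType) (n : nat).
Implicit Types (J I : {mpoly K[n]} -> Prop) (P : seq 'X_{1..n}).
Implicit Types (H : seq {mpoly K[n]}).

Definition homogeneous_ideal I : Prop :=
  is_ideal I /\ forall p k, I p -> I (pihomog mdeg k p).

Definition ideal_of_terms (S : 'X_{1..n} -> Prop) : {mpoly K[n]} -> Prop :=
  ideal_gen (fun q => exists2 m, S m & q = 'X_[m]).

Definition monomial_ideal J : Prop :=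
  exists S : 'X_{1..n} -> Prop, forall p, J p <-> ideal_of_terms S p.

(* Variables are ordered by their index. No index satisfies either predicate
   when m is the term 1. *)
Definition is_min_var (m : 'X_{1..n}) (i : 'I_n) : bool :=
  (m i != 0)%N && [forall j : 'I_n, (m j != 0)%N ==> (i <= j)%N].

Definition is_max_var (m : 'X_{1..n}) (i : 'I_n) : bool :=
  (m i != 0)%N && [forall j : 'I_n, (m j != 0)%N ==> (j <= i)%N].

Definition quasi_stable J : Prop :=
  monomial_ideal J /\
  forall (t : 'X_{1..n}) (i k : 'I_n),
    J 'X_[t] -> is_min_var t i -> (i < k)%N ->
    exists e : nat, J 'X_[(t - U_(i) + U_(k) *+ e)%MM].

(* max(u) <= min(s), vacuously true when u = 1 or s = 1: the second case makes
   {1} the Pommaret basis of the unit ideal. *)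
Definition max_le_min (u s : 'X_{1..n}) : Prop :=
  forall i j, is_max_var u i -> is_min_var s j -> (i <= j)%N.

Definition pommaret_basis J P : Prop :=
  (forall p, J p <-> ideal_of_terms (fun m => m \in P) p) /\
  forall t : 'X_{1..n}, J 'X_[t] -> t \notin P ->
    exists! s : 'X_{1..n},
      s \in P /\ exists2 u : 'X_{1..n}, t = (u + s)%MM & max_le_min u s.

Definition marked_set J P H : Prop :=
  exists h : 'X_{1..n} -> {mpoly K[n]},
    H =i [seq h a | a <- P] /\
    forall a, a \in P ->
      [/\ exists t : nat, h a \is t.-homog,
          (h a)@_a = 1 &
          forall b, b \in msupp (h a) -> b != a -> ~ J 'X_[b]].

(* The K-span of the terms of degree t not in J. *)
Definition normal_span J (t : nat) : {mpoly K[n]} -> Prop := fun p =>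
  forall m, m \in msupp p -> mdeg m = t /\ ~ J 'X_[m].

Definition degree_part I (t : nat) : {mpoly K[n]} -> Prop := fun p =>
  I p /\ p \is t.-homog.

Definition direct_sum (V A B : {mpoly K[n]} -> Prop) : Prop :=
  (forall p, V p <-> exists a b, [/\ A a, B b & p = a + b]) /\
  (forall p, A p -> B p -> p = 0).

Definition marked_basis J P H : Prop :=
  marked_set J P H /\
  forall t : nat,
    direct_sum (fun p => p \is t.-homog)
      (degree_part (ideal_gen (fun p => p \in H)) t)
      (normal_span J t).

End MarkedBases.

Section Reduction.
Variables (K : fieldType) (n d : nat).

(* x_0, ..., x_{d-1}, in this order. *)
Definition first_vars : seq {mpoly K[n]} :=
  [seq 'X_i | i : 'I_n <- enum 'I_n & (i < d)%N].

(* K[x_d, ..., x_{n-1}] is {mpoly K[n - d]}, its j-th variable being x_{d+j}.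
   The sum below is 'X_j if i = d + j, and is empty if i < d. *)
Definition kill_first (p : {mpoly K[n]}) : {mpoly K[n - d]} :=
  p \mPo [tuple \sum_(j < n - d | (i == d + j :> nat)%N) 'X_j | i < n].

(* The image of (I + (x_0, ..., x_{d-1})) / (x_0, ..., x_{d-1}) under the
   isomorphism K[x_0, ..., x_{n-1}] / (x_0, ..., x_{d-1}) = K[x_d, ..., x_{n-1}]
   induced by kill_first. *)
Definition reduction (I : {mpoly K[n]} -> Prop) : {mpoly K[n - d]} -> Prop :=
  fun q => exists2 p, ideal_adjoin I first_vars p & q = kill_first p.

End Reduction.

Arguments first_vars K n d : clear implicits.
Arguments reduction {K n} d I q.

(* Main.v *)
(** Regularity of x_0, ..., x_{d-1} on R/J forces the terms of the Pommaret
    basis to avoid these variables, so the set N(J) of normal terms is stable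
    under multiplication by them.  Together with R = I + <N(J)> (direct sum) this
    gives, for i <= d, R = (I + (x_0, ..., x_{i-1})) + <terms of N(J) prime to
    x_0, ..., x_{i-1}>, again a direct sum, from which both the regularity on R/I
    and the marked basis of the reduction are read off.

    The reduction is Artinian because J contains a power of x_k for every k >= d.
    Otherwise, let D >= d be the largest index of a variable without a power in J.
    By quasi-stability the terms in x_0, ..., x_D are all normal, so
    K[x_0, ..., x_D] embeds in R/I, which is a finite module over it, and going up
    lifts a chain of D + 2 primes, against the definition of d. *)

Require Import Defs.
From mathcomp Require Import all_boot all_order all_algebra.
From mathcomp Require boolp classical_sets.

Set Implicit Arguments.
Unset Strict Implicit.
Unset Printing Implicit Defensive.

Import GRing.Theory.
Local Open Scope ring_scope.

(** * Ideals and primes *)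

Section Ideals.
Variable A : comNzRingType.
Implicit Types (I S W Q : A -> Prop) (s : seq A).

Lemma ideal_opp I f : is_ideal I -> I f -> I (- f).
Proof. by move=> hI If; rewrite -mulN1r; apply: ideal_mul. Qed.

Lemma ideal_sub I f g : is_ideal I -> I f -> I g -> I (f - g).
Proof. by move=> hI If Ig; apply: ideal_add => //; apply: ideal_opp. Qed.

Lemma ideal_sum I (T : Type) (r : seq T) (P : pred T) (F : T -> A) :
  is_ideal I -> (forall i, P i -> I (F i)) -> I (\sum_(i <- r | P i) F i).
Proof.
by move=> hI hF; apply: big_ind => //; [apply: ideal_zero|apply: ideal_add].
Qed.

Lemma ideal_gen_ind S W :
  W 0 -> (forall f g, W f -> W g -> W (f + g)) ->
  (forall f g, S g -> W (f * g)) -> forall f, ideal_gen S f -> W f.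
Proof.
move=> W0 WD WM f [cs hcs ->].
rewrite big_seq; apply: big_ind => // c /hcs; exact: WM.
Qed.

Lemma ideal_gen_sub S f : S f -> ideal_gen S f.
Proof.
move=> Sf; exists [:: (1, f)]; last by rewrite big_seq1 mul1r.
by move=> c; rewrite mem_seq1 => /eqP ->.
Qed.

Lemma ideal_gen_is_ideal S : is_ideal (ideal_gen S).
Proof.
split.
- by exists [::]; rewrite ?big_nil.
- move=> f g [cs hcs ->] [ds hds ->]; exists (cs ++ ds).
    by move=> c; rewrite mem_cat => /orP[/hcs|/hds].
  by rewrite big_cat.
- move=> f g [cs hcs ->]; exists [seq (f * c.1, c.2) | c <- cs].
    by move=> _ /mapP[c /hcs Sc ->].
  by rewrite big_map mulr_sumr; apply: eq_bigr => c _; rewrite mulrA.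
Qed.

Lemma ideal_gen_min S I :
  is_ideal I -> (forall f, S f -> I f) -> forall f, ideal_gen S f -> I f.
Proof.
move=> hI SI; apply: ideal_gen_ind; first exact: ideal_zero.
  exact: ideal_add.
by move=> f g /SI; apply: ideal_mul.
Qed.

Lemma ideal_adjoin_is_ideal I s : is_ideal (ideal_adjoin I s).
Proof. exact: ideal_gen_is_ideal. Qed.

Lemma ideal_adjoin_base I s f : I f -> ideal_adjoin I s f.
Proof. by move=> If; apply: ideal_gen_sub; left. Qed.

Lemma ideal_adjoin_mem I s f : f \in s -> ideal_adjoin I s f.
Proof. by move=> sf; apply: ideal_gen_sub; right. Qed.

Lemma ideal_adjoin1P I f h :
  is_ideal I -> ideal_adjoin I [:: f] h ->
  exists a r, I a /\ h = a + r * f.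
Proof.
move=> hI; move: h; apply: ideal_gen_ind.
- by exists 0, 0; split; [apply: ideal_zero|rewrite mul0r addr0].
- move=> _ _ [a [r [Ia ->]]] [b [t [Ib ->]]]; exists (a + b), (r + t).
  by split; [apply: ideal_add|rewrite mulrDl addrACA].
- move=> r g [Ig|].
    by exists (r * g), 0; rewrite mul0r addr0; split=> //; apply: ideal_mul.
  rewrite mem_seq1 => /eqP ->; exists 0, r; rewrite add0r.
  by split=> //; apply: ideal_zero.
Qed.

(** Krull's argument: an ideal containing [I] and maximal among those disjoint from the
    multiplicative set [S] is prime. It supplies the primes of the chain in the dimension
    argument. *)
Lemma prime_avoidance I S :
  is_ideal I -> S 1 -> (forall f g, S f -> S g -> S (f * g)) ->
  (forall f, I f -> ~ S f) ->
  exists Q, [/\ is_prime Q, forall f, I f -> Q f & forall f, Q f -> ~ S f].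
Proof.
move=> hI S1 SM IS.
pose good Q := [/\ is_ideal Q, forall f, I f -> Q f & forall f, Q f -> ~ S f].
pose P Q := (forall f, ~ Q f) \/ good Q.
have gI : good I by [].
have [F FP Ftot|Q [PQ Qmax]] := @classical_sets.Zorn_bigcup A P.
  have [[B [FB [b Bb]]]|Fempty] := boolp.EM (exists B, F B /\ exists b, B b).
  - right.
    have goodF C x : F C -> C x -> good C.
      by move=> /FP[Cempty /Cempty //|].
    split.
    + split.
      * by exists B => //; apply: ideal_zero; have [] := goodF _ _ FB Bb.
      * move=> f g [C FC Cf] [D FD Dg].
        have [CD|DC] := Ftot _ _ FC FD.
          have [hD _ _] := goodF _ _ FD Dg.
          by exists D => //; apply: ideal_add => //; apply: CD.
        have [hC _ _] := goodF _ _ FC Cf.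
        by exists C => //; apply: ideal_add => //; apply: DC.
      * move=> f g [C FC Cg]; exists C => //.
        by apply: ideal_mul => //; have [] := goodF _ _ FC Cg.
    + by move=> f If; exists B => //; have [_ h _] := goodF _ _ FB Bb; apply: h.
    + by move=> f [C FC Cf]; have [_ _ h] := goodF _ _ FC Cf; apply: h.
  - by left=> f [C FC Cf]; apply: Fempty; exists C; split=> //; exists f.
case: PQ => [Qempty|gQ].
  case: (Qmax I); last by right.
  split; first by move=> f /Qempty.
  by move=> /(_ 0 (ideal_zero hI)); apply: Qempty.
have [hQ IQ QS] := gQ.
exists Q; split=> //; split=> //; first by move=> /QS; apply.
(* By maximality, adjoining an element outside [Q] produces an ideal that meets [S]. *)
have meets f : ~ Q f -> exists a r, Q a /\ S (a + r * f).
  move=> nQf; apply: boolp.contrapT => nS.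
  apply: (Qmax (ideal_adjoin Q [:: f])).
    split; first by move=> g; apply: ideal_adjoin_base.
    move=> /(_ f) sub; apply: nQf; apply: sub.
    by apply: ideal_adjoin_mem; rewrite mem_seq1.
  right; split; first exact: ideal_adjoin_is_ideal.
    by move=> g /IQ; apply: ideal_adjoin_base.
  by move=> h /(ideal_adjoin1P hQ) [a [r [Qa ->]]] Sh; apply: nS; exists a, r.
move=> f g Qfg; apply: boolp.contrapT.
move=> /boolp.not_orP[/meets[a [r [Qa Sa]]] /meets[b [t [Qb Sb]]]].
(* The product of the two elements of [S] is in [S], and it is also in [Q] because [f * g] is. *)
apply: (QS _ _ (SM _ _ Sa Sb)).
rewrite mulrDr; apply: ideal_add => //; first exact: ideal_mul.
rewrite mulrDl; apply: ideal_add => //; first by rewrite mulrC; apply: ideal_mul.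
by rewrite mulrACA; apply: ideal_mul.
Qed.

(* Determinant trick: the adjugate of [y%:M - C] turns the relations into
   [Q (\det (y%:M - C) * b i0)]. *)
Lemma det_trick Q k (b : 'I_k -> A) (i0 : 'I_k) (C : 'M[A]_k) (y : A) :
  is_ideal Q -> b i0 = 1 ->
  (forall i, Q (y * b i - \sum_j C i j * b j)) -> Q (\det (y%:M - C)).
Proof.
move=> hQ b1 hC; pose B : 'cV[A]_k := \col_i b i; pose M := y%:M - C.
have -> : \det (y%:M - C) = (\adj M *m (M *m B)) i0 0.
  by rewrite mulmxA mul_adj_mx mul_scalar_mx !mxE b1 mulr1.
rewrite mxE; apply: ideal_sum => // i _; apply: ideal_mul => //.
suff -> : (M *m B) i 0 = y * b i - \sum_j C i j * b j by [].
rewrite mulmxBl mul_scalar_mx !mxE; congr (_ - _).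
by apply: eq_bigr => j _; rewrite mxE.
Qed.

End Ideals.

(** * Supports of polynomials *)

Section Support.
Variables (K : fieldType) (n : nat).
Implicit Types (T : 'X_{1..n} -> Prop) (p q : {mpoly K[n]}) (m : 'X_{1..n}).

Definition supp_in T p : Prop := forall m, m \in msupp p -> T m.

Lemma supp_in0 T : supp_in T 0.
Proof. by move=> m; rewrite msupp0. Qed.

Lemma supp_inD T p q : supp_in T p -> supp_in T q -> supp_in T (p + q).
Proof. by move=> hp hq m /msuppD_le; rewrite mem_cat => /orP[/hp|/hq]. Qed.

Lemma supp_inN T p : supp_in T p -> supp_in T (- p).
Proof. by move=> hp m; rewrite (perm_mem (msuppN p)) => /hp. Qed.

Lemma supp_inB T p q : supp_in T p -> supp_in T q -> supp_in T (p - q).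
Proof. by move=> hp /supp_inN; apply: supp_inD. Qed.

Lemma supp_inZX T c m : T m -> supp_in T (c *: 'X_[m]).
Proof. by move=> Tm l /msuppZ_le; rewrite msuppX mem_seq1 => /eqP ->. Qed.

Lemma supp_in_sum T (I : Type) (r : seq I) (P : pred I) (F : I -> {mpoly K[n]}) :
  (forall i, P i -> supp_in T (F i)) -> supp_in T (\sum_(i <- r | P i) F i).
Proof.
by move=> hF; apply: big_ind => //; [apply: supp_in0|apply: supp_inD].
Qed.

Lemma supp_inMX T p m :
  supp_in (fun l => T (m + l)%MM) p -> supp_in T (p * 'X_[m]).
Proof. by move=> hp l; rewrite (perm_mem (msuppMX p m)) => /mapP[l' /hp Tl ->]. Qed.

Lemma supp_in_contra T T' p :
  supp_in T p -> supp_in T' p -> (forall m, T m -> ~ T' m) -> p = 0.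
Proof.
move=> Tp T'p TT'; apply/eqP; rewrite -msupp_eq0.
case e : (msupp p) => [//|m s].
have pm : m \in msupp p by rewrite e mem_head.
by case: (TT' m (Tp m pm)); apply: T'p.
Qed.

Lemma ideal_of_supp (I : {mpoly K[n]} -> Prop) p :
  is_ideal I -> supp_in (fun m => I 'X_[m]) p -> I p.
Proof.
move=> hI hp; rewrite (mpolyE p) big_seq; apply: ideal_sum => // m /hp Im.
by rewrite -mul_mpolyC; apply: ideal_mul.
Qed.

Lemma ideal_dvd (I : {mpoly K[n]} -> Prop) l m :
  is_ideal I -> (l <= m)%MM -> I 'X_[l] -> I 'X_[m].
Proof. by move=> hI lm Il; rewrite -(submK lm) mpolyXD; apply: ideal_mul. Qed.

Lemma supp_ideal_of_terms T p :
  ideal_of_terms T p -> supp_in (fun m => exists2 s, T s & (s <= m)%MM) p.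
Proof.
move: p; apply: ideal_gen_ind; [exact: supp_in0|by move=> f g; apply: supp_inD|].
move=> f _ [s Ts ->]; apply: supp_inMX => l _.
by exists s => //; apply: lem_addr.
Qed.

Lemma ideal_of_termsX T m :
  ideal_of_terms T ('X_[m] : {mpoly K[n]}) <-> exists2 s, T s & (s <= m)%MM.
Proof.
split; first by move/supp_ideal_of_terms; apply; rewrite msuppX mem_head.
case=> s Ts sm; apply: ideal_dvd sm _; first exact: ideal_gen_is_ideal.
by apply: ideal_gen_sub; exists s.
Qed.

(** The sum of a monomial ideal and an ideal of variables is monomial, so membership is tested term
    by term. This turns regularity on R/J into a statement about terms. *)
Lemma supp_ideal_adjoin (I : {mpoly K[n]} -> Prop) T (B : pred 'I_n) s p :
  (forall f, I f <-> ideal_of_terms T f) ->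
  (forall f, f \in s -> exists2 i, B i & f = 'X_i) ->
  ideal_adjoin I s p ->
  supp_in (fun m => I 'X_[m] \/ exists2 i, B i & m i != 0%N) p.
Proof.
move=> IE sB; move: p; apply: ideal_gen_ind.
- exact: supp_in0.
- by move=> f g; apply: supp_inD.
- move=> f g [/IE Ig|/sB[i Bi ->]].
    have : ideal_of_terms T (f * g).
      by apply: ideal_mul => //; apply: ideal_gen_is_ideal.
    by move=> /supp_ideal_of_terms sup m /sup h; left; apply/IE/ideal_of_termsX.
  apply: supp_inMX => l _; right; exists i => //.
  by rewrite mnmDE mnm1E eqxx.
Qed.

End Support.

(** * The sequence of the first variables *)

Section FirstVars.
Variables (K : fieldType) (n d : nat).

Lemma first_varsE : first_vars K n d = take d [seq 'X_i | i <- enum 'I_n].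
Proof.
rewrite /first_vars -map_take; congr [seq _ | i <- _].
apply: (inj_map val_inj); rewrite map_take val_enum_ord.
rewrite -(filter_map val (fun i => (i < d)%N)) val_enum_ord take_iota.
have [dn|nd] := leqP d n.
  by rewrite (@filter_iota_ltn 0).
rewrite (@eq_in_filter _ _ predT) ?filter_predT // => i.
by rewrite mem_iota add0n => /andP[_ /ltn_trans]; apply.
Qed.

Lemma size_first_vars : size (first_vars K n d) = minn d n.
Proof. by rewrite first_varsE size_take_min size_map size_enum_ord. Qed.

Lemma nth_first_vars (i : 'I_n) : (i < d)%N -> (first_vars K n d)`_i = 'X_i.
Proof.
move=> id; rewrite first_varsE nth_take // (nth_map i) ?size_enum_ord //.
by rewrite nth_ord_enum.
Qed.

Lemma mem_first_vars f :
  f \in first_vars K n d -> exists2 i : 'I_n, (i < d)%N & f = 'X_i.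
Proof. by case/mapP => i; rewrite mem_filter => /andP[id _] ->; exists i. Qed.

Lemma first_vars_mem (i : 'I_n) : (i < d)%N -> 'X_i \in first_vars K n d.
Proof. by move=> id; apply: map_f; rewrite mem_filter id mem_enum. Qed.

End FirstVars.

Lemma take_first_vars (K : fieldType) (n d k : nat) :
  (k <= d)%N -> take k (first_vars K n d) = first_vars K n k.
Proof. by move=> kd; rewrite !first_varsE take_takel. Qed.

(** * Normal forms modulo a marked basis *)

Section NormalForms.
Variables (K : fieldType) (n : nat) (J I : {mpoly K[n]} -> Prop).
Hypothesis I_ideal : is_ideal I.

Let N m : Prop := ~ J 'X_[m].

Section Marked.
Variables (P : seq 'X_{1..n}) (H : seq {mpoly K[n]}).
Hypothesis H_marked : marked_basis J P H.
Hypothesis H_generates : forall p, I p <-> ideal_gen (fun q => q \in H) p.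

(** The direct sum is given degree by degree: each homogeneous component is decomposed and the
    pieces are added. *)
Lemma marked_normal_form p : exists2 g, I g & supp_in N (p - g).
Proof.
have hom t : exists g, I g /\ supp_in N (pihomog mdeg t p - g).
  have [dec _] := H_marked.2 t.
  have [a [b [[Ia _] Nb ->]]] := (dec _).1 (pihomogP mdeg t p).
  exists a; split; first exact/H_generates.
  by rewrite addrC addKr => m /Nb[].
have [g gP] := fin_all_exists (fun t : 'I_(msize p) => hom t).
exists (\sum_t g t); first by apply: ideal_sum => // t _; have [] := gP t.
rewrite {1}(pihomog_partitionE (leqnn (msize p))) -sumrB.
by apply: supp_in_sum => t _; have [] := gP t.
Qed.

Hypothesis I_homogeneous : forall p k, I p -> I (pihomog mdeg k p).

(** Uniqueness too is known only in each degree; homogeneity of [I] keeps the components of [p] in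
    [I], and a component has no terms beyond those of [p]. *)
Lemma marked_normal_uniq p : I p -> supp_in N p -> p = 0.
Proof.
move=> Ip Np; rewrite (pihomog_partitionE (leqnn (msize p))) big1 // => t _.
apply: (H_marked.2 t).2.
  by split; [apply/H_generates/I_homogeneous|apply: pihomogP].
move=> m mp; have mt := dhomog_mf (pihomogP mdeg t p) mp; split=> //.
apply: Np; move: mp; rewrite pihomogE => /msupp_sum_le /flattenP[s /mapP[l]].
rewrite mem_filter => /andP[_ lp] -> /msuppZ_le.
by rewrite msuppX mem_seq1 => /eqP ->.
Qed.

End Marked.

(** * Adjoining variables whose multiplication preserves the normal terms *)

Section Adjoin.
Variables (B : pred 'I_n) (s : seq {mpoly K[n]}).
Hypothesis normal_form : forall p, exists2 g, I g & supp_in N (p - g).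
Hypothesis normal_uniq : forall p, I p -> supp_in N p -> p = 0.
Hypothesis N_mul : forall m i, B i -> N m -> N (m + U_(i))%MM.
Hypothesis sB : forall f, f \in s -> exists2 i, B i & f = 'X_i.
Hypothesis Bs : forall i, B i -> 'X_i \in s.

(** In a normal form modulo [I], the terms divisible by a variable of [B] lie in the ideal generated
    by [s], so they are moved into [g]. *)
Lemma adjoin_normal_form f : exists2 g,
  ideal_adjoin I s g & supp_in (fun m => N m /\ forall i, B i -> m i = 0%N) (f - g).
Proof.
have hA := ideal_adjoin_is_ideal I s.
have [g Ig Nfg] := normal_form f.
pose b := f - g; pose hasB (m : 'X_{1..n}) := [exists i, B i && (m i != 0%N)].
exists (g + \sum_(m <- msupp b | hasB m) b@_m *: 'X_[m]).
  apply: ideal_add => //; first exact: ideal_adjoin_base.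
  apply: ideal_sum => // m /existsP[i /andP[Bi mi]].
  rewrite -mul_mpolyC; apply: ideal_mul => //.
  apply: (@ideal_dvd _ _ _ U_(i)%MM) => //; first by rewrite lep1mP.
  by apply: ideal_adjoin_mem; apply: Bs.
rewrite opprD addrA -/b {1}(mpolyE b) (bigID hasB) /= addrC addKr.
rewrite big_seq_cond; apply: supp_in_sum => m /andP[mb nB]; apply: supp_inZX.
split; first exact: Nfg.
move=> i Bi; apply/eqP; apply: contraNT nB => mi.
by apply/existsP; exists i; rewrite Bi.
Qed.

(** In a product of [f] and a variable of [B], the factor [f] may be replaced by its normal form
    modulo [I]; by [N_mul] the terms stay normal after multiplication by the variable. *)
Lemma adjoin_normal_remainder f : ideal_adjoin I s f -> exists2 g,
  I g & supp_in (fun m => N m /\ exists2 i, B i & m i != 0%N) (f - g).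
Proof.
move: f; apply: ideal_gen_ind.
- by exists 0; [apply: ideal_zero|rewrite subr0; apply: supp_in0].
- move=> f g [a Ia hf] [b Ib hg]; exists (a + b); first exact: ideal_add.
  by rewrite opprD addrACA; apply: supp_inD.
- move=> f h [Ih|/sB[i Bi ->]].
    by exists (f * h); [apply: ideal_mul|rewrite subrr; apply: supp_in0].
  have [g Ig Nfg] := normal_form f; exists (g * 'X_i).
    by rewrite mulrC; apply: ideal_mul.
  rewrite -mulrBl; apply: supp_inMX => m /Nfg Nm; split.
    by rewrite addmC; apply: N_mul.
  by exists i => //; rewrite mnmDE mnm1E eqxx.
Qed.

(** The difference of [f] and its remainder is normal and in [I], hence zero. Then each term of [f]
    would be both prime to the variables of [B] and divisible by one of them. *)
Lemma adjoin_normal_uniq f : ideal_adjoin I s f ->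
  supp_in (fun m => N m /\ forall i, B i -> m i = 0%N) f -> f = 0.
Proof.
move=> /adjoin_normal_remainder[g Ig hfg] hf.
have g0 : g = 0.
  apply: normal_uniq => //; rewrite -(subKr f g).
  by apply: supp_inB => m; [case/hf|case/hfg].
move: hfg; rewrite g0 subr0 => hf'.
by apply: supp_in_contra hf hf' _ => m [_ h] [_ [i /h ->]].
Qed.

(** The normal form of [f] modulo the larger ideal remains a normal form after multiplication by
    x_k, so uniqueness makes the product zero and x_k cancels in the polynomial ring. *)
Lemma adjoin_regular k f : ~~ B k -> (forall m, N m -> N (m + U_(k))%MM) ->
  ideal_adjoin I s ('X_k * f) -> ideal_adjoin I s f.
Proof.
move=> nBk Nk hkf; have hA := ideal_adjoin_is_ideal I s.
have [g hg hfg] := adjoin_normal_form f.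
suff /eqP : (f - g) * 'X_k = 0.
  by rewrite mulf_eq0 -(msupp_eq0 'X_k) msuppX orbF subr_eq0 => /eqP ->.
apply: adjoin_normal_uniq.
  by rewrite mulrC mulrBr; apply: ideal_sub => //; apply: ideal_mul.
apply: supp_inMX => m /hfg[Nm m0]; split; first by rewrite addmC; apply: Nk.
move=> i Bi; rewrite mnmDE m0 // addn0 mnm1E.
by case: eqP => // ki; rewrite ki Bi in nBk.
Qed.

End Adjoin.
End NormalForms.

(** * Pommaret bases *)

Section Pommaret.
Variables (K : fieldType) (n : nat) (J : {mpoly K[n]} -> Prop) (P : seq 'X_{1..n}).
Hypothesis P_pommaret : pommaret_basis J P.
Implicit Types (m t s u : 'X_{1..n}).

Lemma min_var_exists m (i : 'I_n) : m i != 0%N ->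
  exists2 j, is_min_var m j & (j <= i)%N.
Proof.
move=> mi; have [j mj jmin] := @arg_minnP _ i (fun j => m j != 0%N) val mi.
exists j; last exact: jmin.
by rewrite /is_min_var mj; apply/forallP => l; apply/implyP/jmin.
Qed.

Lemma pommaret_dvd m : J 'X_[m] <-> exists2 s, s \in P & (s <= m)%MM.
Proof.
have [JP _] := P_pommaret; rewrite -(ideal_of_termsX K (fun s => s \in P)).
exact: JP.
Qed.

Lemma pommaret_ideal : is_ideal J.
Proof.
have [JP _] := P_pommaret; have h := ideal_gen_is_ideal
  (fun q : {mpoly K[n]} => exists2 m, m \in P & q = 'X_[m]).
split; first exact/JP/(ideal_zero h).
  by move=> f g /JP Jf /JP Jg; apply/JP/(ideal_add h).
by move=> f g /JP Jg; apply/JP/(ideal_mul h).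
Qed.

Lemma pommaret_decomp t : J 'X_[t] ->
  exists s u, [/\ s \in P, t = (u + s)%MM & max_le_min u s].
Proof.
move=> Jt; have [tP|tP] := boolP (t \in P).
  exists t, 0%MM; split; rewrite ?add0m //.
  by move=> i j; rewrite /is_max_var mnm0E eqxx.
have [s [[sP [u tus us]] _]] := P_pommaret.2 t Jt tP.
by exists s, u.
Qed.

End Pommaret.

(* The definition of a Pommaret basis gives uniqueness only for terms outside
   the basis, whence the multiplication by a large power of the first variable,
   which is below every minimal variable. *)
Lemma pommaret_unique (K : fieldType) (n : nat) (J : {mpoly K[n.+1]} -> Prop)
    (P : seq 'X_{1..n.+1}) (u1 s1 u2 s2 : 'X_{1..n.+1}) :
  pommaret_basis J P -> s1 \in P -> s2 \in P -> (u1 + s1 = u2 + s2)%MM ->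
  max_le_min u1 s1 -> max_le_min u2 s2 -> s1 = s2.
Proof.
move=> hP s1P s2P e us1 us2; set t := (u1 + s1)%MM in e.
pose M := (\max_(s <- P) mdeg s).+1.
pose x : 'X_{1..n.+1} := (U_(ord0) *+ M)%MM.
have xl (l : 'I_n.+1) : l != ord0 -> x l = 0%N.
  by rewrite eq_sym => /negbTE l0; rewrite mulmnE mnm1E l0.
have nP : (x + t)%MM \notin P.
  apply/negP => xtP.
  have := @leq_bigmax_seq _ P xpredT (fun s : 'X_{1..n.+1} => mdeg s) _ xtP isT.
  by rewrite mdegD mdegMn mdeg1 mul1n leqNgt leq_addr.
have Jxt : J 'X_[x + t].
  apply/(pommaret_dvd hP); exists s1 => //.
  by rewrite addmA lem_addl.
have mlm u s : max_le_min u s -> max_le_min (x + u)%MM s.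
  move=> us i j /andP[xui /forallP imax] js.
  have [-> //|i0] := eqVneq i ord0.
  have ui : u i != 0%N by move: xui; rewrite mnmDE xl.
  apply: us js; rewrite /is_max_var ui; apply/forallP => l; apply/implyP => ul.
  by apply: (implyP (imax l)); rewrite mnmDE addn_eq0 negb_and ul orbT.
have [s [_ suniq]] := hP.2 _ Jxt nP.
transitivity s; [symmetry|]; apply: suniq; split=> //.
  by exists (x + u1)%MM; [rewrite addmA|apply: mlm].
by exists (x + u2)%MM; [rewrite e addmA|apply: mlm].
Qed.

Section RegularPommaret.
Variables (K : fieldType) (n : nat) (J : {mpoly K[n.+1]} -> Prop).
Variables (P : seq 'X_{1..n.+1}) (d : nat).
Hypothesis P_pommaret : pommaret_basis J P.
Hypothesis J_regular : regular_sequence_quotient J (first_vars K n.+1 d).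

(* If x_i, i < d, is the smallest variable of s in P then s / x_i is in J, and
   its decomposition yields a second one for s. *)
Lemma pommaret_regular_supp s (i : 'I_n.+1) : s \in P -> (i < d)%N -> s i = 0%N.
Proof.
move=> sP id0; apply/eqP; apply/negPn/negP => si0.
have [k /andP[sk /forallP kmin] ki] := min_var_exists si0.
have kd := leq_ltn_trans ki id0.
pose s' := (s - U_(k))%MM.
have es : s = (U_(k) + s')%MM by rewrite addmC submK // lep1mP.
have Js : J 'X_[s] by apply/(pommaret_dvd P_pommaret); exists s; rewrite ?lepm_refl.
have : ideal_adjoin J (first_vars K n.+1 k) 'X_[s'].
  rewrite -(take_first_vars K n.+1 (ltnW kd)); apply: J_regular.1.
    by rewrite size_first_vars leq_min kd ltn_ord.
  by rewrite nth_first_vars // -mpolyXD -es; apply: ideal_adjoin_base.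
have sub f : f \in first_vars K n.+1 k -> exists2 j : 'I_n.+1, (j < k)%N & f = 'X_j.
  exact: mem_first_vars.
move/(supp_ideal_adjoin (B := fun j : 'I_n.+1 => (j < k)%N) P_pommaret.1 sub)/(_ s').
rewrite msuppX mem_head => /(_ isT)[Js'|[j jk s'j]]; last first.
  have : s j != 0%N by rewrite es mnmDE addn_eq0 negb_and s'j orbT.
  by move/(implyP (kmin j)); rewrite leqNgt jk.
have [s'' [u [s''P es' us'']]] := pommaret_decomp P_pommaret Js'.
suff e : s'' = s.
  have := congr1 (fun m : 'X_{1..n.+1} => mdeg m) es.
  rewrite es' e !mdegD mdeg1 => /eqP.
  by rewrite addnA -[X in X == _]add0n eqn_add2r.
(* The trivial decomposition of [s] is compared with x_k u s''. The latter is admissible because s''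
   divides [s], whose smallest variable is x_k. *)
apply: (pommaret_unique (u1 := (U_(k) + u)%MM) (u2 := 0%MM) P_pommaret) => //.
- by rewrite add0m [RHS]es es' addmA.
- move=> a b /andP[ka /forallP amax] bs''.
  have bs : s b != 0%N.
    by case/andP: bs'' => sb _; rewrite es es' !mnmDE !addn_eq0 !negb_and sb !orbT.
  have [->|ak] := eqVneq a k; first exact: (implyP (kmin b)).
  have ua : u a != 0%N by move: ka; rewrite mnmDE mnm1E (eq_sym k) (negbTE ak).
  apply: us'' bs''; rewrite /is_max_var ua; apply/forallP => l; apply/implyP => ul.
  by apply: (implyP (amax l)); rewrite mnmDE addn_eq0 negb_and ul orbT.
- by move=> a b; rewrite /is_max_var mnm0E eqxx.
Qed.

(** The generators in [P] do not involve x_i, so one that divides m x_i already divides m. *)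
Lemma regular_normal_mul m (i : 'I_n.+1) :
  (i < d)%N -> ~ J 'X_[m] -> ~ J 'X_[m + U_(i)].
Proof.
move=> id0 nJ /(pommaret_dvd P_pommaret)[s sP sm]; apply: nJ.
apply/(pommaret_dvd P_pommaret); exists s => //.
apply/mnm_lepP => j; have := mnm_lepP sm j; rewrite mnmDE mnm1E.
have [<-|_] := eqVneq i j; last by rewrite addn0.
by rewrite pommaret_regular_supp.
Qed.

End RegularPommaret.

(** * Setting the first variables to zero *)

Section Shift.
Variables (n d : nat).
Implicit Types (m : 'X_{1..n}) (t : 'X_{1..n - d}).

Lemma shift_ord_subproof (j : 'I_(n - d)) : (d + j < n)%N.
Proof. by rewrite -ltn_subRL. Qed.

Definition shift_ord (j : 'I_(n - d)) : 'I_n := Ordinal (shift_ord_subproof j).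

Definition unshift_ord (i : 'I_n) : option 'I_(n - d) :=
  if (d <= i)%N then insub (i - d)%N else None.

Lemma shift_ordK : pcancel shift_ord unshift_ord.
Proof. by move=> j; rewrite /unshift_ord leq_addr addKn valK. Qed.

Lemma unshift_ordP (i : 'I_n) : (d <= i)%N ->
  exists2 j, i = shift_ord j & unshift_ord i = Some j.
Proof.
move=> di; have h : (i - d < n - d)%N by rewrite ltn_sub2r // (leq_ltn_trans di).
exists (Ordinal h); first by apply: val_inj; rewrite /= subnKC.
by rewrite /unshift_ord di (insubT (fun j => j < n - d)%N h).
Qed.

Lemma unshift_ord_lt (i : 'I_n) : (i < d)%N -> unshift_ord i = None.
Proof. by move=> id0; rewrite /unshift_ord leqNgt id0. Qed.

Lemma leq_shift_ord j k : (shift_ord j <= shift_ord k)%N = (j <= k)%N.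
Proof. exact: leq_add2l. Qed.

(** The inclusion of the terms in the last variables among those in all variables; [oapp] supplies
    the exponent 0 at indices below [d]. *)
Definition shift_term t : 'X_{1..n} :=
  [multinom oapp t 0%N (unshift_ord i) | i < n].

Definition drop_term m : 'X_{1..n - d} := [multinom m (shift_ord j) | j < n - d].

Lemma shift_termE t j : shift_term t (shift_ord j) = t j.
Proof. by rewrite mnmE shift_ordK. Qed.

Lemma shift_term_lt t (i : 'I_n) : (i < d)%N -> shift_term t i = 0%N.
Proof. by move=> id0; rewrite mnmE unshift_ord_lt. Qed.

Lemma shift_termK : cancel shift_term drop_term.
Proof. by move=> t; apply/mnmP => j; rewrite mnmE shift_termE. Qed.

Lemma drop_termK m : (forall i : 'I_n, (i < d)%N -> m i = 0%N) ->
  shift_term (drop_term m) = m.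
Proof.
move=> m0; apply/mnmP => i; have [id0|/unshift_ordP[j -> _]] := ltnP i d.
  by rewrite shift_term_lt // m0.
by rewrite shift_termE mnmE.
Qed.

Lemma shift_termD t u : shift_term (t + u)%MM = (shift_term t + shift_term u)%MM.
Proof.
by apply/mnmP => i; rewrite !mnmE; case: unshift_ord => //= j; rewrite !mnmE.
Qed.

Lemma shift_termB t u : shift_term (t - u)%MM = (shift_term t - shift_term u)%MM.
Proof.
by apply/mnmP => i; rewrite !mnmE; case: unshift_ord => //= j; rewrite !mnmE.
Qed.

Lemma shift_termMn t e : shift_term (t *+ e)%MM = (shift_term t *+ e)%MM.
Proof.
by apply/mnmP => i; rewrite mulmnE !mnmE; case: unshift_ord => //= j; rewrite mulmnE.
Qed.

Lemma shift_term1 j : shift_term U_(j)%MM = U_(shift_ord j)%MM.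
Proof.
apply/mnmP => i; rewrite mnm1E; have [id0|/unshift_ordP[k -> _]] := ltnP i d.
  rewrite shift_term_lt //; case: eqP => // e.
  by move: id0; rewrite -e /= ltnNge leq_addr.
by rewrite shift_termE mnm1E (inj_eq (pcan_inj shift_ordK)).
Qed.

Lemma mdeg_shift_term t : mdeg (shift_term t) = mdeg t.
Proof.
rewrite [in LHS](multinomUE_id t).
have -> : shift_term (\sum_j U_(j) *+ t j)%MM = (\sum_j U_(shift_ord j) *+ t j)%MM.
  rewrite (big_morph shift_term shift_termD (id1 := 0%MM)).
    by apply: eq_bigr => j _; rewrite shift_termMn shift_term1.
  by apply/mnmP => i; rewrite !mnmE; case: unshift_ord => //= j; rewrite !mnmE.
by rewrite mdeg_sum mdegE; apply: eq_bigr => j _; rewrite mdegMn mdeg1 mul1n.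
Qed.

Lemma shift_term_supp t i : shift_term t i != 0%N ->
  exists2 j, i = shift_ord j & t j != 0%N.
Proof.
have [id0|/unshift_ordP[j -> _]] := ltnP i d; first by rewrite shift_term_lt.
by rewrite shift_termE; exists j.
Qed.

Lemma is_min_var_shift t j : is_min_var (shift_term t) (shift_ord j) = is_min_var t j.
Proof.
rewrite /is_min_var shift_termE; congr (_ && _); apply/forallP/forallP => h k.
  by have := h (shift_ord k); rewrite shift_termE leq_shift_ord.
apply/implyP => /shift_term_supp[l -> tl].
by rewrite leq_shift_ord; apply: (implyP (h l)).
Qed.

Lemma is_max_var_shift t j : is_max_var (shift_term t) (shift_ord j) = is_max_var t j.
Proof.
rewrite /is_max_var shift_termE; congr (_ && _); apply/forallP/forallP => h k.
  by have := h (shift_ord k); rewrite shift_termE leq_shift_ord.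
apply/implyP => /shift_term_supp[l -> tl].
by rewrite leq_shift_ord; apply: (implyP (h l)).
Qed.

Lemma max_le_min_shift t u :
  max_le_min (shift_term t) (shift_term u) <-> max_le_min t u.
Proof.
split=> h i j.
  by rewrite -is_max_var_shift -is_min_var_shift -leq_shift_ord; apply: h.
move=> hi hj; have [i' ei _] := shift_term_supp (proj1 (andP hi)).
have [j' ej _] := shift_term_supp (proj1 (andP hj)).
by move: hi hj; rewrite ei ej is_max_var_shift is_min_var_shift leq_shift_ord; apply: h.
Qed.

Lemma lem_shift t u : (shift_term t <= shift_term u)%MM = (t <= u)%MM.
Proof.
apply/mnm_lepP/mnm_lepP => h i; first by rewrite -!shift_termE.
have [id0|/unshift_ordP[j -> _]] := ltnP i d; first by rewrite !shift_term_lt.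
by rewrite !shift_termE.
Qed.

End Shift.

(** * The specialization map, its section and its kernel *)

Section KillFirst.
Variables (K : fieldType) (n d : nat).
Local Notation kill := (@kill_first K n d).
Local Notation shift_term := (@shift_term n d).
Implicit Types (p : {mpoly K[n]}) (q : {mpoly K[n - d]}).

Lemma kill_first_ord (i : 'I_n) :
  \sum_(j < n - d | (i == d + j :> nat)%N) 'X_j
  = oapp (fun j => 'X_j : {mpoly K[n - d]}) 0 (unshift_ord d i).
Proof.
have [id0|/unshift_ordP[j ei ->]] := ltnP i d.
  rewrite unshift_ord_lt // big_pred0 // => j.
  by apply/negP => /eqP e; move: id0; rewrite e ltnNge leq_addr.
rewrite (big_pred1 j) // => k /=.
by rewrite ei /= eqn_add2l eq_sym.
Qed.

Lemma kill_firstX m : kill 'X_[m] =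
  if [forall i : 'I_n, (i < d)%N ==> (m i == 0%N)] then 'X_[drop_term d m] else 0.
Proof.
rewrite /kill_first comp_mpolyX; case: ifP => [/forallP m0|/negbT].
  rewrite mpolyXE_id (bigID (fun i : 'I_n => d <= i)%N) /= [X in _ * X]big1 ?mulr1.
    rewrite (reindex_omap (shift_ord (d := d)) (@unshift_ord n d)) /=.
      apply: eq_big => j; first by rewrite leq_addr shift_ordK eqxx.
      by move=> _; rewrite tnth_mktuple kill_first_ord shift_ordK mnmE.
    by move=> i /unshift_ordP[j -> ->].
  move=> i; rewrite -ltnNge => id0.
  by rewrite (eqP (implyP (m0 i) id0)) expr0.
rewrite negb_forall => /existsP[i]; rewrite negb_imply => /andP[id0 mi].
rewrite (bigD1 i) //= tnth_mktuple kill_first_ord unshift_ord_lt //.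
by rewrite expr0n (negbTE mi) mul0r.
Qed.

(** By linearity only terms matter, and each is either killed or renumbered. Supports and
    homogeneity under [kill] are read off this formula. *)
Lemma mcoeff_kill_first p t : (kill p)@_t = p@_(shift_term t).
Proof.
have -> : kill p = \sum_(m <- msupp p) p@_m *: kill 'X_[m].
  exact: comp_mpolyEX.
rewrite [in RHS](mpolyE p) !raddf_sum /=; apply: eq_bigr => m _.
rewrite !mcoeffZ; congr (_ * _); rewrite kill_firstX mcoeffX.
case: ifP => [/forallP m0|/negbT h].
  rewrite mcoeffX; congr (nat_of_bool _)%:R.
  apply/eqP/eqP => [<-|->]; last exact: shift_termK.
  by rewrite drop_termK // => i id0; apply/eqP/(implyP (m0 i)).
rewrite mcoeff0; case: eqP => // e; case/negP: h.
by apply/forallP => i; apply/implyP => id0; rewrite e shift_term_lt.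
Qed.

Lemma msupp_kill_first p t : (t \in msupp (kill p)) = (shift_term t \in msupp p).
Proof. by rewrite !mcoeff_msupp mcoeff_kill_first. Qed.

Lemma kill_first_homog p t : p \is t.-homog -> kill p \is t.-homog.
Proof.
move=> /dhomogP hp; apply/dhomogP => m; rewrite msupp_kill_first => /hp <-.
exact/esym/mdeg_shift_term.
Qed.

Lemma kill_first_var (i : 'I_n) : (i < d)%N -> kill 'X_i = 0.
Proof.
move=> id0; rewrite kill_firstX; case: ifP => // /forallP/(_ i).
by rewrite id0 mnm1E eqxx.
Qed.

(** The inclusion of K[x_d, ..., x_{n-1}] into K[x_0, ..., x_{n-1}], used as a section of [kill]. *)
Definition shift_poly q : {mpoly K[n]} :=
  \sum_(t <- msupp q) q@_t *: 'X_[shift_term t].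

Lemma kill_shift_poly q : kill (shift_poly q) = q.
Proof.
rewrite /kill_first raddf_sum /= [RHS]mpolyE; apply: eq_bigr => t _.
rewrite comp_mpolyZ -/(kill _) kill_firstX shift_termK; case: forallP => // -[] i.
by apply/implyP => id0; rewrite shift_term_lt.
Qed.

Lemma supp_shift_poly q :
  supp_in (fun m => exists2 t, t \in msupp q & m = shift_term t) (shift_poly q).
Proof.
rewrite /shift_poly big_seq; apply: supp_in_sum => t tq; apply: supp_inZX.
by exists t.
Qed.

Lemma shift_poly_homog q t : q \is t.-homog -> shift_poly q \is t.-homog.
Proof.
move=> /dhomogP hq; apply/dhomogP => _ /supp_shift_poly[m /hq <- ->].
exact: mdeg_shift_term.
Qed.

(** A term free of x_0, ..., x_{d-1} would survive in [kill p], so every term of [p] is a multiple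
    of one of the adjoined variables. *)
Lemma kill_first_ker (I : {mpoly K[n]} -> Prop) p :
  kill p = 0 -> ideal_adjoin I (first_vars K n d) p.
Proof.
move=> kp; apply: ideal_of_supp; first exact: ideal_adjoin_is_ideal.
move=> m mp.
have [/forallP m0|] := boolP [forall i : 'I_n, (i < d)%N ==> (m i == 0%N)].
  have := msupp_kill_first p (drop_term d m).
  rewrite kp msupp0 drop_termK ?mp // => i id0; exact/eqP/(implyP (m0 i)).
rewrite negb_forall => /existsP[i]; rewrite negb_imply => /andP[id0 mi].
apply: (@ideal_dvd _ _ _ U_(i)%MM); first exact: ideal_adjoin_is_ideal.
  by rewrite lep1mP.
by apply: ideal_adjoin_mem; apply: first_vars_mem.
Qed.

(** The adjoined variables are sent to zero, so I and its sum with them have the same image. *)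
Lemma reductionP (I : {mpoly K[n]} -> Prop) q :
  is_ideal I -> reduction d I q <-> exists2 p, I p & q = kill p.
Proof.
move=> hI; split=> [[p hp ->]|[p Ip ->]]; last first.
  by exists p => //; apply: ideal_adjoin_base.
move: p hp; apply: ideal_gen_ind.
- by exists 0; [apply: ideal_zero|].
- move=> f g [a Ia ea] [b Ib eb]; exists (a + b); first exact: ideal_add.
  by rewrite /kill_first !rmorphD /= -!/(kill _) ea eb.
- move=> f g [Ig|/mem_first_vars[i id0 ->]].
    by exists (f * g) => //; apply: ideal_mul.
  exists 0; first exact: ideal_zero.
  rewrite /kill_first rmorphM /= -!/(kill _) kill_first_var // mulr0.
  by rewrite /kill_first rmorph0.
Qed.

Lemma reduction_is_ideal (I : {mpoly K[n]} -> Prop) :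
  is_ideal I -> is_ideal (reduction d I).
Proof.
move=> hI; split.
- apply/(reductionP _ hI); exists 0; first exact: ideal_zero.
  by rewrite /kill_first rmorph0.
- move=> _ _ /(reductionP _ hI)[f If ->] /(reductionP _ hI)[g Ig ->].
  apply/(reductionP _ hI); exists (f + g); first exact: ideal_add.
  by rewrite /kill_first rmorphD.
- move=> f _ /(reductionP _ hI)[g Ig ->]; apply/(reductionP _ hI).
  exists (shift_poly f * g); first exact: ideal_mul.
  by rewrite /kill_first rmorphM /= -!/(kill _) kill_shift_poly.
Qed.

Lemma reduction_gen (I : {mpoly K[n]} -> Prop) (H : seq {mpoly K[n]}) :
  (forall p, I p <-> ideal_gen (fun f => f \in H) p) ->
  forall q, reduction d I q <-> ideal_gen (fun f => f \in [seq kill h | h <- H]) q.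
Proof.
move=> IH; have hG := ideal_gen_is_ideal (fun f => f \in H).
have hI : is_ideal I.
  split; first exact/IH/(ideal_zero hG).
    by move=> f g /IH If /IH Ig; apply/IH/(ideal_add hG).
  by move=> f g /IH Ig; apply/IH/(ideal_mul hG).
move=> q; split.
  have h := ideal_gen_is_ideal (fun f => f \in [seq kill h | h <- H]).
  move=> /(reductionP _ hI)[p /IH Ip ->]; move: p Ip; apply: ideal_gen_ind.
  - by rewrite /kill_first rmorph0; apply: ideal_zero.
  - by move=> f g; rewrite /kill_first rmorphD; apply: ideal_add.
  - move=> f g gH; rewrite /kill_first rmorphM; apply: ideal_mul => //.
    by apply: ideal_gen_sub; apply: map_f.
apply: ideal_gen_min; first exact: reduction_is_ideal.
move=> _ /mapP[g gH ->]; apply/(reductionP _ hI); exists g => //.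
exact/IH/ideal_gen_sub.
Qed.

End KillFirst.

(** * The marked basis of the reduction *)

Section ReductionBasis.
Variables (K : fieldType) (n d : nat) (J : {mpoly K[n]} -> Prop) (P : seq 'X_{1..n}).
Hypothesis P_pommaret : pommaret_basis J P.
Hypothesis P_supp : forall s (i : 'I_n), s \in P -> (i < d)%N -> s i = 0%N.
Local Notation kill := (@kill_first K n d).
Local Notation shift_term := (@shift_term n d).
Local Notation drop_term := (@drop_term n d).

Let J_ideal : is_ideal J := pommaret_ideal P_pommaret.

(** If the term [t] is the image of some [p] in [J], then [shift_term t] occurs in [p], and [J],
    being monomial, contains every term of [p]. *)
Lemma reductionX t : reduction d J 'X_[t] <-> J 'X_[shift_term t].
Proof.
split=> [/(reductionP _ J_ideal)[p Jp e]|Jt]; last first.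
  apply/(reductionP _ J_ideal); exists 'X_[shift_term t] => //.
  rewrite kill_firstX shift_termK; case: forallP => // -[] i.
  by apply/implyP => id0; rewrite shift_term_lt.
apply/(pommaret_dvd P_pommaret).
move/P_pommaret.1: Jp => /supp_ideal_of_terms; apply.
by rewrite -msupp_kill_first -e msuppX mem_head.
Qed.

Lemma shift_drop_pommaret s : s \in P -> shift_term (drop_term s) = s.
Proof. by move=> sP; apply: drop_termK => i; apply: P_supp. Qed.

(** The terms of [P] avoid the killed variables and only need renumbering; the decompositions of [t]
    correspond to those of [shift_term t]. *)
Lemma reduction_pommaret : pommaret_basis (reduction d J) [seq drop_term s | s <- P].
Proof.
have hR := reduction_is_ideal d J_ideal; split=> [q|t Rt tP].
  split; last first.
    apply: ideal_gen_min => // _ [_ /mapP[s sP ->] ->].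
    apply/reductionX/(pommaret_dvd P_pommaret); exists s => //.
    by rewrite shift_drop_pommaret // lepm_refl.
  move=> /(reductionP _ J_ideal)[p /P_pommaret.1 Jp ->].
  apply: ideal_of_supp; first exact: ideal_gen_is_ideal.
  move=> t; rewrite msupp_kill_first => /(supp_ideal_of_terms Jp)[s sP st].
  apply/(ideal_of_termsX K (fun m => m \in [seq drop_term s | s <- P])).
  exists (drop_term s); first exact: map_f.
  by rewrite -lem_shift shift_drop_pommaret.
have tP' : shift_term t \notin P.
  by apply: contra tP => tP; apply/mapP; exists (shift_term t); rewrite ?shift_termK.
have [s [[sP [u e us]] suniq]] := P_pommaret.2 _ (iffLR (reductionX t) Rt) tP'.
(* The cofactor divides a shifted term, so it avoids the killed variables and can be renumbered as
   well. *)
have u0 (i : 'I_n) : (i < d)%N -> u i = 0%N.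
  move=> id0; have := congr1 (fun m : 'X_{1..n} => m i) e.
  by rewrite /= shift_term_lt // mnmDE => /esym/eqP; rewrite addn_eq0 => /andP[/eqP].
exists (drop_term s); split.
  split; first exact: map_f.
  exists (drop_term u).
    apply: (can_inj (@shift_termK n d)).
    by rewrite shift_termD (drop_termK u0) shift_drop_pommaret.
  by apply/max_le_min_shift; rewrite (drop_termK u0) shift_drop_pommaret.
move=> _ [/mapP[s' s'P ->] [u' e' us']]; congr drop_term; apply: suniq; split=> //.
exists (shift_term u'); first by rewrite e' shift_termD shift_drop_pommaret.
by move/max_le_min_shift: us'; rewrite shift_drop_pommaret.
Qed.

Lemma reduction_quasi_stable : quasi_stable J -> quasi_stable (reduction d J).
Proof.
move=> [_ qs]; split.
  by exists (fun m => m \in [seq drop_term s | s <- P]); exact: reduction_pommaret.1.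
move=> t i k /reductionX Jt it ik.
have [|||e he] := qs (shift_term t) (shift_ord i) (shift_ord k) => //.
- by rewrite is_min_var_shift.
- by rewrite /= ltn_add2l.
exists e; apply/reductionX.
by rewrite shift_termD shift_termB shift_termMn !shift_term1.
Qed.

Section Marked.
Variables (I : {mpoly K[n]} -> Prop) (H : seq {mpoly K[n]}).
Hypothesis I_homogeneous : homogeneous_ideal I.
Hypothesis H_marked : marked_basis J P H.
Hypothesis H_generates : forall p, I p <-> ideal_gen (fun q => q \in H) p.
Hypothesis N_mul :
  forall m (i : 'I_n), (i < d)%N -> ~ J 'X_[m] -> ~ J 'X_[m + U_(i)].

(** The lift [shift_poly q] differs from an element of [I] by an element of the kernel of [kill],
    and its terms are normal and free of the killed variables; [adjoin_normal_uniq] then applies. *)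
Lemma reduction_normal_uniq q : reduction d I q ->
  supp_in (fun t => ~ reduction d J 'X_[t]) q -> q = 0.
Proof.
have [hI hom] := I_homogeneous.
have hA := ideal_adjoin_is_ideal I (first_vars K n d).
move=> /(reductionP _ hI)[p Ip ep] Nq.
suff e0 : shift_poly q = 0 by rewrite -(kill_shift_poly q) e0 /kill_first rmorph0.
have vars f : f \in first_vars K n d -> exists2 i : 'I_n, (i < d)%N & f = 'X_i.
  exact: mem_first_vars.
apply: (adjoin_normal_uniq hI (marked_normal_form hI H_marked H_generates)
  (marked_normal_uniq H_marked H_generates hom)
  (B := fun i : 'I_n => (i < d)%N) N_mul vars).
  rewrite -(subrK p (shift_poly q)).
  apply: (ideal_add hA); last exact: ideal_adjoin_base.
  apply: kill_first_ker.
  by rewrite /kill_first rmorphB /= -!/(kill _) kill_shift_poly ep subrr.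
move=> _ /supp_shift_poly[t tq ->]; split; last by move=> i; apply: shift_term_lt.
by move=> /reductionX; apply: Nq.
Qed.

Lemma reduction_marked_set :
  marked_set (reduction d J) [seq drop_term s | s <- P] [seq kill h | h <- H].
Proof.
have [[h [eH hP]] _] := H_marked.
exists (fun t => kill (h (shift_term t))); split.
  move=> f; apply/mapP/mapP => [[g gH ->]|[_ /mapP[s sP ->] ->]].
    move: gH; rewrite eH => /mapP[s sP ->].
    by exists (drop_term s); [apply: map_f|rewrite shift_drop_pommaret].
  by rewrite shift_drop_pommaret //; exists (h s) => //; rewrite eH map_f.
move=> _ /mapP[s sP ->]; rewrite shift_drop_pommaret //.
have [[t ht] h1 hN] := hP s sP; split.
- by exists t; apply: kill_first_homog.
- by rewrite mcoeff_kill_first shift_drop_pommaret.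
move=> b; rewrite msupp_kill_first => bs bne /reductionX; apply: hN => //.
by apply: contraNneq bne => <-; rewrite shift_termK.
Qed.

(** A homogeneous [q] is lifted along [shift_poly], decomposed in the large ring and sent back by
    [kill], which preserves degree and normality. *)
Lemma reduction_marked_basis :
  marked_basis (reduction d J) [seq drop_term s | s <- P] [seq kill h | h <- H].
Proof.
split=> [|t]; first exact: reduction_marked_set.
have genE := reduction_gen (d := d) H_generates.
split=> [q|q [/genE Iq _] Nq]; last first.
  by apply: reduction_normal_uniq => // m /Nq[].
split=> [hq|[a [b [[_ ha] hb ->]]]]; last first.
  apply: rpredD => //; apply/dhomogP => m /hb[<- _]; reflexivity.
have [dec _] := H_marked.2 t.
have [a [b [[Ia ha] Nb e]]] := (dec _).1 (shift_poly_homog hq).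
exists (kill a), (kill b); split.
- split; last exact: kill_first_homog.
  apply/genE/(reductionP _ I_homogeneous.1); exists a => //.
  exact/H_generates.
- move=> m; rewrite msupp_kill_first => /Nb[<- nJ].
  by rewrite mdeg_shift_term; split=> // /reductionX.
- by rewrite -[LHS]kill_shift_poly e /kill_first rmorphD.
Qed.

End Marked.
End ReductionBasis.

(** * Dimension *)

Section KillVars.
Variables (K : fieldType) (n : nat).
Implicit Types (B : pred 'I_n) (p : {mpoly K[n]}).

(** The map stays in the same ring, so its fixed points are exactly the polynomials in the variables
    outside [B]; polynomial subrings are encoded below by this equation. *)
Definition kill_vars B p : {mpoly K[n]} :=
  p \mPo [tuple if B i then 0 else 'X_i | i < n].

Lemma kill_varsX B m : kill_vars B 'X_[m] =
  if [forall i, B i ==> (m i == 0%N)] then 'X_[m] else 0.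
Proof.
rewrite /kill_vars comp_mpolyX; case: ifP => [/forallP m0|/negbT].
  rewrite mpolyXE_id; apply: eq_bigr => i _; rewrite tnth_mktuple.
  by case: ifP => // Bi; rewrite (eqP (implyP (m0 i) Bi)) !expr0.
rewrite negb_forall => /existsP[i]; rewrite negb_imply => /andP[Bi mi].
by rewrite (bigD1 i) //= tnth_mktuple Bi expr0n (negbTE mi) mul0r.
Qed.

Lemma mcoeff_kill_vars B p m : (kill_vars B p)@_m =
  if [forall i, B i ==> (m i == 0%N)] then p@_m else 0.
Proof.
have -> : kill_vars B p = \sum_(l <- msupp p) p@_l *: kill_vars B 'X_[l].
  exact: comp_mpolyEX.
have coefX l : (kill_vars B 'X_[l])@_m =
    if [forall i, B i ==> (m i == 0%N)] then ('X_[l])@_m else 0.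
  rewrite kill_varsX mcoeffX; have [->|lm] := eqVneq l m.
    by case: ifP; rewrite ?mcoeff0 // mcoeffX eqxx.
  by rewrite if_same; case: ifP; rewrite ?mcoeff0 // mcoeffX (negbTE lm).
rewrite raddf_sum /= [in RHS](mpolyE p) raddf_sum /=.
rewrite (eq_bigr _ (fun l _ => mcoeffZ _ _ _)).
rewrite (eq_bigr _ (fun l _ => congr1 _ (coefX l))).
case: ifP => _; first by apply: eq_bigr => l _; rewrite mcoeffZ.
by rewrite big1 // => l _; rewrite mulr0.
Qed.

Lemma kill_vars_comp B B' p : subpred B B' ->
  kill_vars B' (kill_vars B p) = kill_vars B' p.
Proof.
move=> BB'; apply/mpolyP => m; rewrite !mcoeff_kill_vars.
case: ifP => // /forallP m0; case: forallP => // -[] i.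
by apply/implyP => /BB' B'i; apply: (implyP (m0 i)).
Qed.

Lemma kill_vars_supp B p : kill_vars B p = p ->
  supp_in (fun m : 'X_{1..n} => forall i, B i -> m i = 0%N) p.
Proof.
move=> <- m; rewrite mcoeff_msupp mcoeff_kill_vars; case: ifP; last by rewrite eqxx.
by move=> /forallP m0 _ i Bi; apply/eqP/(implyP (m0 i)).
Qed.

Lemma kill_vars_fixX B (m : 'X_{1..n}) : (forall i, B i -> m i = 0%N) ->
  kill_vars B 'X_[m] = 'X_[m].
Proof.
move=> m0; rewrite kill_varsX; case: forallP => // -[] i.
by apply/implyP => /m0 ->.
Qed.

Lemma kill_vars_var B i : B i -> kill_vars B 'X_i = 0.
Proof.
by move=> Bi; rewrite kill_varsX; case: forallP => // /(_ i); rewrite Bi mnm1E eqxx.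
Qed.

End KillVars.

(* Going up along (x_0) < (x_0, x_1) < ... in the subring K[x_0, ..., x_{D-1}]
   of R/I, over which R/I is a finite module. *)
Section PrimeChain.
Variables (K : fieldType) (n D : nat) (I : {mpoly K[n]} -> Prop).
Hypothesis I_ideal : is_ideal I.
Hypothesis D_le : (D <= n)%N.

Local Notation sub_ring a := (kill_vars (fun i : 'I_n => (D <= i)%N) a = a).
Local Notation phi l := (kill_vars (fun i : 'I_n => (i < l)%N)).

Hypothesis I_sub_ring : forall a, sub_ring a -> I a -> a = 0.
Variables (k : nat) (b : 'I_k -> {mpoly K[n]}) (i0 : 'I_k).
Hypothesis b_i0 : b i0 = 1.
Hypothesis b_gen : forall p, exists c : 'I_k -> {mpoly K[n]},
  (forall j, sub_ring (c j)) /\ I (p - \sum_j c j * b j).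

(** This is the complement of the prime (x_0, ..., x_{l-1}) in K[x_0, ..., x_{D-1}]. A prime is
    [good l] when it contains [I] and its contraction to the subring lies in that prime. *)
Let S l (a : {mpoly K[n]}) : Prop := sub_ring a /\ phi l a != 0.
Let good l (Q : {mpoly K[n]} -> Prop) : Prop :=
  [/\ is_prime Q, forall f, I f -> Q f & forall f, Q f -> ~ S l f].

Lemma chain_mult l f g : S l f -> S l g -> S l (f * g).
Proof.
move=> [f1 f2] [g1 g2]; split.
  by rewrite /kill_vars rmorphM /= -!/(kill_vars _ _) f1 g1.
by rewrite /kill_vars rmorphM mulf_neq0.
Qed.

Lemma chain_one l : S l 1.
Proof. by split; rewrite /kill_vars rmorph1 // oner_eq0. Qed.

Lemma chain_base : exists Q, good 0 Q.
Proof.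
apply: (prime_avoidance I_ideal (chain_one 0) (@chain_mult 0)).
move=> f If [fs]; rewrite (I_sub_ring fs If).
by rewrite /kill_vars rmorph0 eqxx.
Qed.

(** A prime over [Q] and x_l disjoint from [S l.+1] is sought. If f = q + r x_l were in [S l.+1],
    with q in [Q], then with [M] the matrix of multiplication by r on the generators, det(f - x_l M)
    would lie in [Q] and in the subring. Its image under [phi l.+1] is a power of that of f, hence
    nonzero, which contradicts [good l Q]. *)
Lemma chain_step l Q : (l < D)%N -> good l Q ->
  exists Q', [/\ good l.+1 Q', forall f, Q f -> Q' f & exists2 f, Q' f & ~ Q f].
Proof.
move=> lD [prQ IQ QS]; have hQ := prime_is_ideal prQ.
pose x := Ordinal (leq_trans lD D_le).
have phix : phi l.+1 'X_x = 0 :> {mpoly K[n]} by apply: kill_vars_var => /=.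
have subx : sub_ring ('X_x : {mpoly K[n]}).
  apply: kill_vars_fixX => i Di; rewrite mnm1E; case: eqP => // e.
  by move: Di; rewrite -e leqNgt /= lD.
have [f|Q' [prQ' QQ' Q'S]] := prime_avoidance
    (ideal_adjoin_is_ideal Q [:: 'X_x]) (chain_one l.+1) (@chain_mult l.+1).
  move=> /(ideal_adjoin1P hQ)[q [r [Qq ef]]] [fs /negP]; apply; apply/eqP.
  have [C hC] := fin_all_exists (fun i => b_gen (r * b i)).
  pose M : 'M_k := \matrix_(i, j) C i j.
  have Qdet : Q (\det (f%:M - 'X_x *: M)).
    apply: (det_trick hQ b_i0) => i.
    have -> : f * b i - \sum_j ('X_x *: M) i j * b j
        = b i * q + 'X_x * (r * b i - \sum_j C i j * b j).
      rewrite mulrBr mulr_sumr ef mulrDl addrA [q * _]mulrC mulrAC mulrA.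
      rewrite [r * _ * _]mulrC mulrA.
      by congr (_ - _); apply: eq_bigr => j _; rewrite !mxE mulrA.
    apply: (ideal_add hQ); first exact: ideal_mul.
    by apply: ideal_mul => //; apply/IQ; have [] := hC i.
  have map_det B : kill_vars B (\det (f%:M - 'X_x *: M)) =
      \det ((kill_vars B f)%:M - kill_vars B 'X_x *: map_mx (kill_vars B) M).
    rewrite -[LHS](det_map_mx (comp_mpoly _)); congr (\det _).
    by rewrite map_mxB map_scalar_mx map_mxZ.
  have sub_det : sub_ring (\det (f%:M - 'X_x *: M)).
    rewrite map_det fs subx; congr (\det (_ - _ *: _)).
    by apply/matrixP => i j; rewrite !mxE; have [] := hC i.
  have : phi l.+1 (\det (f%:M - 'X_x *: M)) = phi l.+1 f ^+ k.
    by rewrite map_det phix scale0r subr0 det_scalar.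
  move: (\det _) Qdet sub_det => delta Qdelta sub_delta; clear map_det.
  have delta0 : phi l delta = 0.
    by have [//|nz] := eqVneq (phi l delta) 0; case: (QS _ Qdelta); split.
  (* Since [phi l.+1] factors through [phi l], it kills [delta] too, and with it a power of
     [phi l.+1 f]. *)
  rewrite -(@kill_vars_comp _ _ (fun i : 'I_n => i < l)%N); last by move=> i /= /ltnW.
  rewrite delta0 {1}/kill_vars rmorph0 => /esym/eqP.
  by rewrite expf_eq0 => /andP[_ /eqP].
exists Q'; split=> //.
- by split=> // f /IQ Qf; apply: QQ'; apply: ideal_adjoin_base.
- by move=> f Qf; apply: QQ'; apply: ideal_adjoin_base.
exists 'X_x; first by apply: QQ'; apply: ideal_adjoin_mem; rewrite mem_seq1.
(* The inclusion is strict: x_l is fixed by [phi l], so it belongs to [S l], which [Q] does not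
   meet. *)
move=> /QS; apply; split=> //; rewrite kill_vars_fixX.
  by rewrite -msupp_eq0 msuppX.
by move=> i il; rewrite mnm1E; case: eqP => // e; move: il; rewrite -e /= ltnn.
Qed.

Lemma sub_ring_prime_chain : prime_chain_over I D.
Proof.
have chain l : (l <= D)%N -> exists Q : nat -> {mpoly K[n]} -> Prop,
    (forall i, (i <= l)%N -> good i (Q i)) /\
    forall i, (i < l)%N ->
      (forall f, Q i f -> Q i.+1 f) /\ (exists2 f, Q i.+1 f & ~ Q i f).
  elim: l => [_|l IH lD].
    have [Q gQ] := chain_base; exists (fun=> Q); split=> i; last by rewrite ltn0.
    by rewrite leqn0 => /eqP ->; apply: gQ.
  have [Q [gQ cQ]] := IH (ltnW lD).
  have [Q' [gQ' sQ' pQ']] := chain_step lD (gQ l (leqnn l)).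
  (* The new prime sits at index [l.+1] and serves as default value beyond it. *)
  exists (fun i => if (i <= l)%N then Q i else Q'); split=> i.
    rewrite leq_eqVlt => /orP[/eqP ->|]; first by rewrite ltnn.
    by rewrite ltnS => il; rewrite il; apply: gQ.
  rewrite ltnS => il; have [->|ne] := eqVneq i l.
    by rewrite leqnn ltnn; split; [apply: sQ'|apply: pQ'].
  have il' : (i < l)%N by rewrite ltn_neqAle ne.
  by rewrite il il'; apply: cQ.
have [Q [gQ cQ]] := chain D (leqnn D).
by exists Q; split=> // i /gQ[].
Qed.

End PrimeChain.

(** * Normal terms and finiteness of R/I over a polynomial subring *)

Section NormalTerms.
Variables (K : fieldType) (n : nat) (J : {mpoly K[n]} -> Prop).
Implicit Types (m : 'X_{1..n}).

(** As long as a variable below x_k remains, quasi-stability trades one factor of the smallest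
    variable for a power of x_k. The total exponent outside x_k drops each time, until a pure power
    is left. *)
Lemma quasi_stable_power m (k : 'I_n) : quasi_stable J -> J 'X_[m] ->
  (forall i : 'I_n, (k < i)%N -> m i = 0%N) -> exists e, J 'X_[U_(k) *+ e].
Proof.
move=> [_ qs]; have [w] := ubnP (\sum_(i | i != k) m i)%N.
elim: w m => // w IH m; rewrite ltnS => mw Jm mk.
have [/existsP[i /andP[ik mi]]|/existsPn m0] :=
  boolP [exists i, (i != k) && (m i != 0%N)].
  have [j jmin ji] := min_var_exists mi.
  have mj : m j != 0%N by case/andP: jmin.
  have jk : (j < k)%N.
    have : (i <= k)%N by rewrite leqNgt; apply: contraNN mi => /mk ->.
    by rewrite leq_eqVlt (negbTE (ik : (i != k :> nat))) => /(leq_ltn_trans ji).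
  have [e Je] := qs m j k Jm jmin jk.
  have nkj : (k == j) = false by apply/eqP => e'; rewrite e' ltnn in jk.
  apply: IH Je _; last first.
    move=> l kl; rewrite mnmDE mnmBE mulmnE mk // !mnm1E sub0n.
    by case: eqP => // e'; rewrite e' ltnn in kl.
  apply: leq_trans mw.
  rewrite (bigD1 j) /= ?[X in (_ < X)%N](bigD1 j) /= 1?eq_sym ?nkj //.
  rewrite mnmDE mnmBE mulmnE !mnm1E eqxx nkj mul0n addn0 subn1.
  rewrite -addSn prednK ?lt0n // leq_add2l; apply: leq_sum => l /andP[lk lj].
  rewrite mnmDE mnmBE mulmnE !mnm1E (eq_sym k) (negbTE lk) mul0n addn0.
  exact: leq_subr.
exists (m k); suff <- : m = (U_(k) *+ m k)%MM by [].
apply/mnmP => i; rewrite mulmnE mnm1E; have [->|ki] := eqVneq k i.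
  by rewrite mul1n.
by have := m0 i; rewrite (eq_sym i) ki mul0n => /negPn/eqP.
Qed.

Hypothesis J_ideal : is_ideal J.

(** A normal term is not divisible by the pure powers in [J], which bounds its exponents at indices
    from [D] on. *)
Lemma normal_terms_bounded D :
  (forall k : 'I_n, (D <= k)%N -> exists e, J 'X_[U_(k) *+ e]) ->
  exists b, forall m, ~ J 'X_[m] ->
    (forall i : 'I_n, (i < D)%N -> m i = 0%N) -> (mdeg m < b)%N.
Proof.
move=> pow.
have /fin_all_exists[e he] (k : 'I_n) : exists e, (D <= k)%N -> J 'X_[U_(k) *+ e].
  by have [_|/pow[e Je]] := ltnP k D; [exists 0%N|exists e].
exists (\sum_k e k).+1 => m nJ m0; rewrite ltnS mdegE; apply: leq_sum => i _.
have [/m0 -> //|Di] := ltnP i D.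
rewrite leqNgt; apply/negP => ei; apply: nJ.
apply: ideal_dvd (he i Di) => //; apply/mnm_lepP => j; rewrite mulmnE mnm1E.
by have [<-|_] := eqVneq i j; rewrite ?mul1n // ltnW.
Qed.

Variable I : {mpoly K[n]} -> Prop.
Hypothesis I_ideal : is_ideal I.
Hypothesis J_proper : ~ J 1.
Hypothesis normal_form :
  forall p, exists2 g, I g & supp_in (fun m => ~ J 'X_[m]) (p - g).

(** A normal term splits into a part in x_0, ..., x_{D-1}, used as coefficient, and a part in the
    other variables, which divides a normal term and thus is normal of bounded degree. The terms of
    bounded degree therefore generate. *)
Lemma normal_finite D :
  (forall k : 'I_n, (D <= k)%N -> exists e, J 'X_[U_(k) *+ e]) ->
  exists k (b : 'I_k -> {mpoly K[n]}) i0, b i0 = 1 /\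
    forall p, exists c : 'I_k -> {mpoly K[n]},
      (forall j, kill_vars (fun i : 'I_n => (D <= i)%N) (c j) = c j) /\
      I (p - \sum_j c j * b j).
Proof.
move=> /normal_terms_bounded[bd hbd].
(* The determinant trick needs 1 among the generators; the term 1 is normal because [J] is
   proper. *)
have bd0 : (mdeg (0%MM : 'X_{1..n}) < bd)%N.
  by apply: hbd => [|i _]; rewrite ?mnm0E // mpolyX0.
pose T : finType := 'X_{1..n < bd}.
pose b (j : 'I_#|T|) : {mpoly K[n]} := 'X_[bmnm (enum_val j)].
exists #|T|, b, (enum_rank (BMultinom bd0)).
split; first by rewrite /b enum_rankK mpolyX0.
pose W (p : {mpoly K[n]}) := exists c : 'I_#|T| -> {mpoly K[n]},
  (forall j, kill_vars (fun i : 'I_n => (D <= i)%N) (c j) = c j) /\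
      I (p - \sum_j c j * b j).
have W0 p : I p -> W p.
  move=> Ip; exists (fun=> 0); split=> [j|]; first by rewrite /kill_vars rmorph0.
  by rewrite big1 ?subr0 // => j _; rewrite mul0r.
have WD p q : W p -> W q -> W (p + q).
  move=> [c [cs Ic]] [c' [cs' Ic']]; exists (fun j => c j + c' j); split=> [j|].
    by rewrite /kill_vars rmorphD /= -!/(kill_vars _ _) cs cs'.
  rewrite (eq_bigr _ (fun j _ => mulrDl _ _ _)) big_split opprD addrACA.
  exact: ideal_add.
have WX (a : K) m : ~ J 'X_[m] -> W (a *: 'X_[m]).
  move=> nJ; pose mA := [multinom (if (i < D)%N then m i else 0%N) | i < n].
  pose mB := [multinom (if (i < D)%N then 0%N else m i) | i < n].
  have em : m = (mA + mB)%MM.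
    by apply/mnmP => i; rewrite mnmDE !mnmE; case: ifP; rewrite ?addn0.
  have mBb : (mdeg mB < bd)%N.
    apply: hbd => [JB|i iD]; last by rewrite mnmE iD.
    by apply: nJ; apply: ideal_dvd JB; rewrite // em lem_addl.
  exists (fun j => if j == enum_rank (BMultinom mBb) then a *: 'X_[mA] else 0).
  split=> [j|].
    case: ifP => _; last by rewrite /kill_vars rmorph0.
    rewrite /kill_vars comp_mpolyZ -/(kill_vars _ _) kill_vars_fixX // => i Di.
    by rewrite mnmE ltnNge Di.
  rewrite (bigD1 (enum_rank (BMultinom mBb))) //= eqxx big1 => [|j /negbTE ->].
    rewrite /b enum_rankK /= addr0 -scalerAl -mpolyXD -em subrr.
    exact: ideal_zero.
  by rewrite mul0r.
move=> p; have [g Ig Ng] := normal_form p.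
rewrite -/(W p) -(subrK g p); apply: (WD _ _ _ (W0 _ Ig)).
rewrite (mpolyE (p - g)) big_seq.
apply: big_ind; [exact: W0 (ideal_zero I_ideal)|exact: WD|].
by move=> m mp; apply: WX; apply: Ng.
Qed.

Hypothesis normal_uniq :
  forall p, I p -> supp_in (fun m => ~ J 'X_[m]) p -> p = 0.

Lemma power_of_krull_dim d : quasi_stable J -> krull_dim_quotient I d ->
  forall k : 'I_n, (d <= k)%N -> exists e, J 'X_[U_(k) *+ e].
Proof.
move=> qs [_ dmax].
(* The number [r] counts the variables of index at least [D], so that induction on it moves [D] down
   from [n] to [d]. *)
have pow r D : (D + r = n)%N -> (d <= D)%N ->
    forall k : 'I_n, (D <= k)%N -> exists e, J 'X_[U_(k) *+ e].
  elim: r D => [|r IH] D Dr dD k Dk.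
    by move: (ltn_ord k); rewrite ltnNge -[X in (X <= _)%N]Dr addn0 Dk.
  have powS : forall k : 'I_n, (D < k)%N -> exists e, J 'X_[U_(k) *+ e].
    by apply: IH; [rewrite addSnnS|rewrite leqW].
  apply: boolp.contrapT => nopow.
  have eD : k = D :> nat.
    by apply/eqP; rewrite eqn_leq Dk andbT leqNgt; apply/negP => /powS.
  have [c [b [i0 [b1 bgen]]]] := normal_finite powS.
  have Dn : (D < n)%N by rewrite -eD.
  have : prime_chain_over I D.+1.
    (* A term in x_0, ..., x_D lying in [J] would yield a power of x_D in [J]; hence the subring
       consists of normal polynomials and meets [I] only in 0. *)
    apply: (sub_ring_prime_chain I_ideal Dn _ b1 bgen) => a /kill_vars_supp asupp Ia.
    apply: normal_uniq => // m /asupp m0 Jm; apply: nopow.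
    by apply: (quasi_stable_power qs Jm) => i; rewrite eD; apply: m0.
  by move=> /dmax; rewrite ltnNge dD.
move=> k dk; apply: (pow (n - d)%N d) => //.
by rewrite subnKC // (leq_trans dk) // ltnW.
Qed.

End NormalTerms.

(** * The Artinian property *)

Section Artinian.
Variables (K : fieldType) (n : nat) (I : {mpoly K[n]} -> Prop) (b : nat).
Hypothesis bounded_rest :
  forall p, exists2 g, I g & supp_in (fun m => (mdeg m < b)%N) (p - g).

Let T : finType := 'X_{1..n < b}.
(** Polynomials of degree below [b] are encoded by coefficient vectors, so that linear independence
    becomes [row_free]. *)
Let pol (v : 'rV[K]_#|T|) : {mpoly K[n]} :=
  \sum_j v 0 j *: 'X_[bmnm (enum_val j)].

Lemma pol_mulmx r (x : 'rV[K]_r) (A : 'M[K]_(r, #|T|)) :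
  pol (x *m A) = \sum_i x 0 i *: pol (row i A).
Proof.
rewrite /pol (eq_bigr _ (fun i _ => scaler_sumr _ _ _ _)) exchange_big /=.
apply: eq_bigr => j _; rewrite mxE scaler_suml; apply: eq_bigr => i _.
by rewrite mxE scalerA.
Qed.

Lemma pol_rest p : exists2 g, I g & exists v, p = g + pol v.
Proof.
have [g Ig hg] := bounded_rest p; exists g => //.
exists (\row_j (p - g)@_(bmnm (enum_val j))).
have msz : (msize (p - g) <= b)%N.
  by rewrite mmeasureE big_seq; apply/bigmax_leqP_seq => m mp _; apply: hg.
pose F (m : T) := (p - g)@_(bmnm m) *: 'X_[bmnm m].
rewrite /pol (eq_bigr (fun j => F (enum_val j))) => [|j _]; last by rewrite mxE.
by rewrite -(big_enum_val (A := T) F) /= -mpolywE // addrC subrK.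
Qed.

(* If a descending chain of ideals is not stationary, vectors witnessing ever
   later strict inclusions are linearly independent modulo I. *)
Lemma artinian_of_bounded : artinian_quotient I.
Proof.
move=> C Cid IC Cdec; apply: boolp.contrapT => nstat.
have Cmono k l : (k <= l)%N -> forall f, C l f -> C k f.
  by move=> /subnK <-; elim: (l - k)%N => // r IH f; rewrite addSn => /Cdec/IH.
(* A witness of a strict inclusion may be reduced to bounded degree, because every ideal of the
   chain contains [I]. *)
have drop N : exists k, (N <= k)%N /\ exists v, C N (pol v) /\ ~ C k (pol v).
  apply: boolp.contrapT => nk; apply: nstat; exists N => k Nk f CNf.
  apply: boolp.contrapT => nCkf; apply: nk; exists k; split=> //.
  have [g Ig [v ef]] := pol_rest f; exists v; split.
    have -> : pol v = f - g by rewrite ef addrC addKr.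
    by apply: ideal_sub => //; apply: IC.
  by move=> Ckv; apply: nCkf; rewrite ef; apply: ideal_add => //; apply: IC.
(* The statement holds for all [N] so that, after choosing a vector outside [C k], the remaining
   rows can be taken inside [C k]; the new vector is then not in their span. *)
have indep r : forall N, exists A : 'M[K]_(r, #|T|),
    row_free A /\ forall i, C N (pol (row i A)).
  elim: r => [|r IH] N.
    by exists 0; split; [rewrite /row_free -leqn0 rank_leq_row|case].
  have [k [Nk [v [CNv nCkv]]]] := drop N; have [A [freeA CA]] := IH k.
  rewrite -[r.+1]/(1 + r)%N; exists (col_mx v A); split.
    apply: inj_row_free => w; rewrite -[w]hsubmxK mul_row_col.
    set x := rsubmx _; rewrite [lsubmx _]mx11_scalar; set a := _ 0 0.
    rewrite mul_scalar_mx => e.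
    have a0 : a = 0.
      apply/eqP/negPn/negP => a0; apply: nCkv.
      have -> : v = (- a^-1 *: x) *m A.
        apply: (scalerI a0); rewrite -scalemxAl scalerA mulrN divff // scaleN1r.
        by apply/eqP; rewrite -addr_eq0; apply/eqP.
      rewrite pol_mulmx; apply: ideal_sum => // i _.
      by rewrite -mul_mpolyC; apply: ideal_mul.
    move: e; rewrite a0 scale0r add0r => /eqP; rewrite mulmx_free_eq0 // => /eqP ->.
    by rewrite raddf0 row_mx0.
  move=> i; rewrite -[i](@splitK 1 r); case: (split i) => j /=.
    by rewrite rowKu row_id.
  by rewrite rowKd; apply: (Cmono _ _ Nk).
have [A [/eqP freeA _]] := indep #|T|.+1 0%N.
by have := rank_leq_col A; rewrite freeA ltnn.
Qed.

End Artinian.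

(** * Regularity on R/I and the Artinian reduction *)

Theorem proposition3p5 (K : fieldType) (n : nat)
    (J I : {mpoly K[n.+1]} -> Prop) (P : seq 'X_{1..n.+1})
    (H : seq {mpoly K[n.+1]}) (d : nat)
    (J_quasi_stable : quasi_stable J)
    (P_pommaret : pommaret_basis J P)
    (I_homogeneous : homogeneous_ideal I)
    (H_marked : marked_basis J P H)
    (H_generates : forall p, I p <-> ideal_gen (fun q => q \in H) p)
    (dim_I : krull_dim_quotient I d)
    (J_regular : regular_sequence_quotient J (first_vars K n.+1 d)) :
  regular_sequence_quotient I (first_vars K n.+1 d) /\
  [/\ artinian_quotient (reduction d I),
      quasi_stable (reduction d J),
      forall q, reduction d I q <->
        ideal_gen (fun f => f \in [seq kill_first d h | h <- H]) q &
      exists P' : seq 'X_{1..n.+1 - d},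
        pommaret_basis (reduction d J) P' /\
        marked_basis (reduction d J) P' [seq kill_first d h | h <- H]].
Proof.
have J_ideal := pommaret_ideal P_pommaret.
have [I_ideal I_hom] := I_homogeneous.
have J_proper : ~ J 1 by move=> J1; apply: J_regular.2; apply: ideal_adjoin_base.
have P_supp := pommaret_regular_supp P_pommaret J_regular.
have N_mul := regular_normal_mul P_pommaret J_regular.
have normal_form := marked_normal_form I_ideal H_marked H_generates.
have normal_uniq := marked_normal_uniq H_marked H_generates I_hom.
have R_marked := reduction_marked_basis P_pommaret P_supp I_homogeneous H_marked
  H_generates (fun m i => @N_mul m i).
have R_gen := reduction_gen (d := d) H_generates.
have R_ideal := reduction_is_ideal d I_ideal.
split; last first.
  have R_pommaret := reduction_pommaret P_pommaret P_supp.
  split=> //; last by exists [seq drop_term d s | s <- P].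
    have [b hb] := normal_terms_bounded J_ideal
      (power_of_krull_dim J_ideal I_ideal J_proper normal_form normal_uniq
        J_quasi_stable dim_I).
    (* Normal terms of the reduction shift to normal terms of [J] free of x_0, ..., x_{d-1}, whose
       degree is below [b]. *)
    apply: (artinian_of_bounded (b := b)) => p.
    have [g Ig Ng] := marked_normal_form R_ideal R_marked R_gen p.
    exists g => // t /Ng nt; rewrite -mdeg_shift_term; apply: hb.
      by move=> Jt; apply: nt; apply/(reductionX P_pommaret).
    by move=> i; apply: shift_term_lt.
  exact: reduction_quasi_stable P_pommaret P_supp J_quasi_stable.
split=> [i|].
  rewrite size_first_vars leq_min => /andP[id0 i_n] f.
  rewrite (take_first_vars _ _ (ltnW id0)) (nth_first_vars _ (i := Ordinal i_n)) //.
  apply: (adjoin_regular I_ideal normal_form normal_uniq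
    (B := fun j : 'I_n.+1 => (j < i)%N)).
  - by move=> m j ji; apply: N_mul; apply: ltn_trans id0.
  - exact: mem_first_vars.
  - by move=> j; apply: first_vars_mem.
  - by rewrite /= ltnn.
  - by move=> m; apply: N_mul.
(* The term 1 is normal and involves no variable, so it would be zero if it belonged to the
   ideal. *)
move=> I1; case/eqP: (oner_neq0 {mpoly K[n.+1]}).
apply: (adjoin_normal_uniq I_ideal normal_form normal_uniq
  (B := fun j : 'I_n.+1 => (j < d)%N) N_mul _ I1).
  exact: mem_first_vars.
move=> m; rewrite msupp1 mem_seq1 => /eqP ->; split; first by rewrite mpolyX0.
by move=> i _; rewrite mnm0E.
Qed.
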